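(* Let $(M,\varphi,\xi,\eta,g)$ be a $3$-dimensional trans-Sasakian manifold equipped with a Newman--Penrose frame $(\partial,\overline{\partial},\xi)$. Then the structure vector field $\xi$ is harmonic if and only if $\partial(\rho_{\mathrm{np}})=0$.
   Context: An almost contact metric structure $(\varphi,\xi,\eta,g)$ on $M$: $\varphi$ a $(1,1)$-tensor, $\xi$ a vector field, $\eta$ a $1$-form, $g$ a Riemannian metric with $\varphi^2=-I+\eta\otimes\xi$, $\eta(\xi)=1$, $\varphi\xi=0$, $\eta\circ\varphi=0$, $g(\varphi X,\varphi Y)=g(X,Y)-\eta(X)\eta(Y)$. It is trans-Sasakian of type $(\alpha,\beta)$ ($\alpha,\beta$ smooth functions) if $(\nabla_X\varphi)Y=\alpha(g(X,Y)\xi-\eta(Y)X)+\beta(g(\varphi X,Y)\xi-\eta(Y)\varphi X)$, with $\nabla$ the Levi-Civita connection. Newman--Penrose frame: for an orthonormal frame $(e_1,e_2,\xi)$, put $\partial=\frac1{\sqrt2}(e_1-ie_2)$, $\overline{\partial}=\frac1{\sqrt2}(e_1+ie_2)$, chosen so that $\varphi\partial=i\partial$, $\varphi\overline{\partial}=-i\overline{\partial}$ (i.e. $\varphi e_1=e_2$). All tensors and $\nabla$ are extended complex-(multi)linearly. Put $\sigma_{\mathrm{np}}=-g(\partial,\nabla_\partial\xi)$, $\rho_{\mathrm{np}}=g(\partial,\nabla_{\overline{\partial}}\xi)$, $\kappa_{\mathrm{np}}=-g(\partial,\nabla_\xi\xi)$. In these terms the trans-Sasakian condition of type $(\alpha,\beta)$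 reads $\kappa_{\mathrm{np}}=\sigma_{\mathrm{np}}=0$, $\rho_{\mathrm{np}}=\beta+i\alpha$. For a function $f$, $\partial(f)$ denotes the derivative along $\partial$. Rough Laplacian (with $e_3=\xi$): $\Delta_gX=-\sum_{i=1}^3\bigl(\nabla_{e_i}\nabla_{e_i}X-\nabla_{\nabla_{e_i}e_i}X\bigr)$. The unit vector field $\xi$ is called harmonic if $\Delta_g\xi=\|\nabla\xi\|^2\xi$, where $\|\nabla\xi\|^2=\sum_{i=1}^3 g(\nabla_{e_i}\xi,\nabla_{e_i}\xi)$. *)

(* Defs.v *)
From HB Require Import structures.
From mathcomp Require Import all_boot all_order all_algebra.
From mathcomp Require Import all_classical all_reals all_analysis.
From mathcomp.real_closed Require Import complex.
From mathcomp Require Import ring.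

Set Implicit Arguments.
Unset Strict Implicit.
Unset Printing Implicit Defensive.

Import Order.TTheory GRing.Theory Num.Theory numFieldNormedType.Exports.

Local Open Scope classical_set_scope.
Local Open Scope ring_scope.
Local Open Scope complex_scope.

Section Smooth.
Context {R : realType} {n : nat} {V : normedModType R}.
Implicit Types (U : set 'rV[R]_n) (f : 'rV[R]_n -> V).

(* Meaningful for open U: the values of f outside U are then irrelevant. *)
Fixpoint Ck (k : nat) U f : Prop :=
  (forall x, U x -> {for x, continuous f}) /\
  if k is k'.+1 then
    forall i : 'I_n, (forall x, U x -> derivable f x (delta_mx 0 i)) /\
                     Ck k' U ('D_(delta_mx 0 i) f)
  else True.

Definition smooth_on U f := forall k, Ck k U f.

End Smooth.

(* A chart is a homeomorphism from the open set [cdom] of M onto the open set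
   [cimg] of R^n; both [cmap] and its inverse [cinv] are total functions whose
   values outside these sets are irrelevant. *)
Record chart (R : realType) (n : nat) (M : topologicalType) := Chart {
  cdom : set M;
  cimg : set 'rV[R]_n;
  cmap : M -> 'rV[R]_n;
  cinv : 'rV[R]_n -> M;
  cdom_open : open cdom;
  cimg_open : open cimg;
  cmap_img : forall p, cdom p -> cimg (cmap p);
  cinv_dom : forall x, cimg x -> cdom (cinv x);
  cmapK : forall p, cdom p -> cinv (cmap p) = p;
  cinvK : forall x, cimg x -> cmap (cinv x) = x;
  cmap_continuous : forall p, cdom p -> {for p, continuous cmap};
  cinv_continuous : forall x, cimg x -> {for x, continuous cinv} }.

HB.mixin Record isManifold (R : realType) (n : nat) M of Topological M := {
  atlas : set (chart R n M);
  atlas_cover : forall p : M, exists2 c, atlas c & cdom c p;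
  atlas_compatible : forall c c', atlas c -> atlas c' ->
    smooth_on (cimg c `&` cinv c @^-1` cdom c') (cmap c' \o cinv c);
  manifold_hausdorff : hausdorff_space M;
  manifold_second_countable : @second_countable M }.

#[short(type="manifoldType")]
HB.structure Definition Manifold (R : realType) (n : nat) :=
  {M of isManifold R n M & Topological M}.

Section CkTheory.
Context {R : realType} {n : nat}.
Implicit Types (U : set 'rV[R]_n) (f g : 'rV[R]_n -> R).

Lemma Ck_ext k U f g : open U -> {in U, f =1 g} -> Ck k U f -> Ck k U g.
Proof.
move=> oU; elim: k f g => [|k IH] f g fg /= [cf df].
all: have nfg x : U x -> {near x, f =1 g}
  by move=> Ux; near=> y; apply: fg; rewrite inE; near: y;
    exact: open_nbhs_nbhs.
all: have cg x : U x -> {for x, continuous g}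
  by move=> Ux; have := cf x Ux;
    rewrite /prop_for /continuous_at (nbhs_singleton (nfg _ Ux));
    apply: cvg_trans; apply: (near_eq_cvg (FF := nbhs_filter x)); exact: nfg.
all: split=> // i; have [dfi Cfi] := df i; split=> [x Ux|].
  by apply: near_eq_derivable (dfi _ Ux); apply: nfg.
apply: IH Cfi => x; rewrite inE => Ux.
exact: near_eq_derive (nfg _ Ux).
Unshelve. all: by end_near.
Qed.

Lemma CkW k U f : Ck k.+1 U f -> Ck k U f.
Proof.
elim: k f => [|k IH] f [cf df]; first by split.
by split=> // i; have [dfi Cfi] := df i; split=> //; exact: IH.
Qed.

Lemma Ck_cst k U (c : R) : Ck k U (cst c).
Proof.
elim: k c => [|k IH] c; split=> //; try by move=> x _; exact: cst_continuous.
move=> i; split=> [x _|]; first exact: derivable_cst.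
by have -> : 'D_(delta_mx 0 i) (cst c) = cst 0 :> ('rV[R]_n -> R)
  by apply/funext => x; exact: derive_cst.
Qed.

Lemma CkB k U f g : open U -> Ck k U f -> Ck k U g -> Ck k U (f - g).
Proof.
move=> oU; elim: k f g => [|k IH] f g /= [cf df] [cg dg].
all: split=> //; try by move=> x Ux; exact: (cvgB (cf _ Ux) (cg _ Ux)).
move=> i; have [dfi Cfi] := df i; have [dgi Cgi] := dg i; split=> [x Ux|].
  exact: derivableB (dfi _ Ux) (dgi _ Ux).
apply: Ck_ext oU _ (IH _ _ Cfi Cgi) => x; rewrite inE => Ux.
by rewrite (deriveB (dfi _ Ux) (dgi _ Ux)).
Qed.

Lemma CkD k U f g : open U -> Ck k U f -> Ck k U g -> Ck k U (f + g).
Proof.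
move=> oU Cf Cg; have -> : f + g = f - (cst 0 - g).
  by apply/funext => x; rewrite !fctE sub0r opprK.
by apply: CkB => //; apply: CkB => //; exact: Ck_cst.
Qed.

Lemma CkM k U f g : open U -> Ck k U f -> Ck k U g -> Ck k U (f * g).
Proof.
move=> oU; elim: k f g => [|k IH] f g Cf Cg.
all: have [[cf df] [cg dg]] := (Cf, Cg).
all: split=> //; try by move=> x Ux; exact: (cvgM (cf _ Ux) (cg _ Ux)).
move=> i; have [dfi Cfi] := df i; have [dgi Cgi] := dg i; split=> [x Ux|].
  exact: derivableM (dfi _ Ux) (dgi _ Ux).
have := CkD oU (IH _ _ (CkW Cf) Cgi) (IH _ _ (CkW Cg) Cfi).
apply: Ck_ext oU _ => x; rewrite inE => Ux.
by rewrite (deriveM (dfi _ Ux) (dgi _ Ux)).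
Qed.

End CkTheory.

Section SmoothFunctions.
Context {R : realType} {n : nat} {M : manifoldType R n}.

Definition smooth_fun : {pred M -> R} := fun f =>
  `[< forall c : chart R n M, atlas c -> smooth_on (cimg c) (f \o cinv c) >].

Lemma smooth_fun_subring_closed : subring_closed smooth_fun.
Proof.
split=> [|f g|f g].
- by apply/asboolP => c _ k; exact: Ck_cst.
- move=> /asboolP sf /asboolP sg; apply/asboolP => c ac k.
  by apply: CkB; [exact: cimg_open|exact: sf|exact: sg].
- move=> /asboolP sf /asboolP sg; apply/asboolP => c ac k.
  by apply: CkM; [exact: cimg_open|exact: sf|exact: sg].
Qed.

HB.instance Definition _ :=
  GRing.isSubringClosed.Build (M -> R) smooth_fun smooth_fun_subring_closed.

End SmoothFunctions.

Record smooth (R : realType) (n : nat) (M : manifoldType R n) := Smooth {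
  smooth_val :> M -> R;
  smooth_valP : smooth_val \in smooth_fun }.

Section SmoothRing.
Context {R : realType} {n : nat} {M : manifoldType R n}.

HB.instance Definition _ := [isSub for @smooth_val R n M].
HB.instance Definition _ := [Choice of smooth M by <:].
HB.instance Definition _ := GRing.SubChoice_isSubComPzRing.Build
  (M -> R) smooth_fun (smooth M) (subringClosedP smooth_fun).

Lemma cst_smooth (a : R) : (cst a : M -> R) \in smooth_fun.
Proof. by apply/asboolP => c _ k; exact: Ck_cst. Qed.

Definition smooth_cst (a : R) : smooth M := Smooth (cst_smooth a).

End SmoothRing.

Section VectorFields.
Context {R : realType} {n : nat} {M : manifoldType R n}.

Definition derivation : {pred smooth M -> (smooth M)^o} := fun X =>
  `[< [/\ forall f h : smooth M, X (f + h) = X f + X h,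
          forall (a : R) (f : smooth M),
            X (smooth_cst a * f) = smooth_cst a * (X f : smooth M) &
          forall f h : smooth M,
            X (f * h) = (X f : smooth M) * h + f * (X h : smooth M)] >].

Lemma derivation_submod_closed : submod_closed derivation.
Proof.
split=> [|f X Y /asboolP[XD XZ XM] /asboolP[YD YZ YM]]; apply/asboolP.
  by split=> *; rewrite ?fctE ?addr0 ?mulr0 ?mul0r ?addr0.
split=> [h k|a h|h k]; rewrite !fctE /GRing.scale /=.
- by rewrite XD YD mulrDr addrACA.
- by rewrite XZ YZ mulrDr mulrCA.
- rewrite XM YM !mulrDr mulrDl mulrA addrACA; congr (_ + (_ + _)).
  exact: mulrCA.
Qed.

HB.instance Definition _ :=
  GRing.isSubmodClosed.Build (smooth M) (smooth M -> (smooth M)^o)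
    derivation derivation_submod_closed.

End VectorFields.

Record vfield (R : realType) (n : nat) (M : manifoldType R n) := VField {
  vfield_val : smooth M -> (smooth M)^o;
  vfield_valP : vfield_val \in derivation }.

Definition vfield_act (R : realType) (n : nat) (M : manifoldType R n)
  (X : vfield M) (f : smooth M) : smooth M := vfield_val X f.
Coercion vfield_act : vfield >-> Funclass.

Section VectorFieldModule.
Context {R : realType} {n : nat} {M : manifoldType R n}.

HB.instance Definition _ := [isSub for @vfield_val R n M].
HB.instance Definition _ := [Choice of vfield M by <:].
HB.instance Definition _ := [SubChoice_isSubLmodule of vfield M by <:].

Lemma bracket_derivation (X Y : vfield M) :
  (fun f => X (Y f) - Y (X f) : (smooth M)^o) \in derivation.
Proof.
case: X Y => [X XP] [Y YP]; rewrite /vfield_act /=.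
move/asboolP: XP => [XD XZ XM]; move/asboolP: YP => [YD YZ YM].
apply/asboolP; split=> [f h|a f|f h].
- by rewrite !(XD, YD) opprD addrACA.
- by rewrite !(XZ, YZ) mulrBr.
- rewrite XM YM XD YD !XM !YM mulrBl mulrBr.
  ring.
Qed.

Definition bracket (X Y : vfield M) : vfield M :=
  VField (bracket_derivation X Y).

(* A tangent vector at p is a derivation at p of the ring of smooth functions. *)
Definition tangent (p : M) (v : smooth M -> R) : Prop :=
  [/\ forall f h : smooth M, v (f + h) = v f + v h,
      forall (a : R) (f : smooth M), v (smooth_cst a * f) = a * v f &
      forall f h : smooth M, v (f * h) = v f * h p + f p * v h].

Definition vfield_at (X : vfield M) (p : M) : smooth M -> R := fun f => X f p.

(* A global frame: a basis of the tangent space at every point. *)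
Definition frame (e : 'I_n -> vfield M) : Prop :=
  forall (p : M) (v : smooth M -> R), tangent p v ->
    exists! c : 'rV[R]_n,
      v = fun f => \sum_(i < n) c 0 i * vfield_at (e i) p f.

End VectorFieldModule.

(* Tensors are multilinear maps of modules over the ring of smooth functions.
   The last two fields state that the form induced on each tangent space is
   positive definite. *)
Record metric (R : realType) (n : nat) (M : manifoldType R n) := Metric {
  metric_val :> vfield M -> vfield M -> smooth M;
  metricC : forall X Y, metric_val X Y = metric_val Y X;
  metric_linear : forall (f : smooth M) X Y Z,
    metric_val (f *: X + Y) Z = f * metric_val X Z + metric_val Y Z;
  metric_ge0 : forall X (p : M), 0 <= metric_val X X p;
  metric_eq0 : forall X (p : M),
    metric_val X X p = 0 <-> vfield_at X p = fun=> 0 }.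

Record connection (R : realType) (n : nat) (M : manifoldType R n) :=
  Connection {
  nabla :> vfield M -> vfield M -> vfield M;
  nabla_linear : forall (f : smooth M) X Y Z,
    nabla (f *: X + Y) Z = f *: nabla X Z + nabla Y Z;
  nablaD : forall X Y Z, nabla X (Y + Z) = nabla X Y + nabla X Z;
  nabla_leibniz : forall X (f : smooth M) Y,
    nabla X (f *: Y) = X f *: Y + f *: nabla X Y }.

Section LeviCivita.
Context {R : realType} {n : nat} {M : manifoldType R n}.
Implicit Types (g : metric M) (D : connection M) (e : 'I_n -> vfield M).

Definition levi_civita g D : Prop :=
  (forall X Y : vfield M, D X Y - D Y X = bracket X Y) /\
  (forall X Y Z : vfield M, X (g Y Z) = g (D X Y) Z + g Y (D X Z)).

Definition orthonormal_frame g e : Prop :=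
  frame e /\ forall i j, g (e i) (e j) = (i == j)%:R.

Definition rough_laplacian D e (X : vfield M) : vfield M :=
  - \sum_(i < n) (D (e i) (D (e i) X) - D (D (e i) (e i)) X).

Definition sqnorm_nabla g D e (X : vfield M) : smooth M :=
  \sum_(i < n) g (D (e i) X) (D (e i) X).

(* For a unit vector field X; e is an orthonormal frame. *)
Definition harmonic_field g D e (X : vfield M) : Prop :=
  rough_laplacian D e X = sqnorm_nabla g D e X *: X.

End LeviCivita.

Record almost_contact_metric (R : realType) (n : nat) (M : manifoldType R n) :=
  AlmostContactMetric {
  phi : {linear vfield M -> vfield M};
  xi : vfield M;
  eta : vfield M -> smooth M;
  acm_metric : metric M;
  eta_linear : forall (f : smooth M) X Y,
    eta (f *: X + Y) = f * eta X + eta Y;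
  phi_phi : forall X, phi (phi X) = - X + eta X *: xi;
  eta_xi : eta xi = 1;
  phi_xi : phi xi = 0;
  eta_phi : forall X, eta (phi X) = 0;
  metric_phi : forall X Y,
    acm_metric (phi X) (phi Y) = acm_metric X Y - eta X * eta Y }.

Section TransSasakian.
Context {R : realType} {n : nat} {M : manifoldType R n}.
Context (S : almost_contact_metric M) (D : connection M).
Local Notation g := (acm_metric S).

(* The left-hand side is (nabla_X phi) Y. *)
Definition trans_sasakian (alpha beta : smooth M) : Prop :=
  forall X Y : vfield M,
    D X (phi S Y) - phi S (D X Y) =
      alpha *: (g X Y *: xi S - eta S Y *: X) +
      beta *: (g (phi S X) Y *: xi S - eta S Y *: phi S X).

End TransSasakian.

Definition complex_linear (U V : Type) (f : U -> V) (x : U[i]) : V[i] :=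
  let: a +i* b := x in f a +i* f b.

Definition complex_bilinear (U V : Type) (W : zmodType) (f : U -> V -> W)
    (x : U[i]) (y : V[i]) : W[i] :=
  let: a +i* b := x in let: c +i* d := y in
  (f a c - f b d) +i* (f a d + f b c).

Section NewmanPenrose.
Context {R : realType} {M : manifoldType R 3}.
Context (S : almost_contact_metric M) (D : connection M) (e1 e2 : vfield M).
Local Notation g := (acm_metric S).
Local Notation isqrt2 := (smooth_cst (Num.sqrt 2)^-1).

Definition frame3 : 'I_3 -> vfield M := tnth [tuple e1; e2; xi S].

Definition np_d : (vfield M)[i] := (isqrt2 *: e1) +i* - (isqrt2 *: e2).
Definition np_dbar : (vfield M)[i] := (isqrt2 *: e1) +i* (isqrt2 *: e2).

Definition complex_scale : (smooth M)[i] -> (vfield M)[i] -> (vfield M)[i] :=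
  complex_bilinear (fun f X => f *: X).

Definition np_frame : Prop :=
  [/\ orthonormal_frame g frame3,
      complex_linear (phi S) np_d = complex_scale (0 +i* 1) np_d &
      complex_linear (phi S) np_dbar = complex_scale (0 +i* -1) np_dbar].

Definition np_rho : (smooth M)[i] :=
  complex_bilinear g np_d (complex_bilinear D np_dbar (xi S +i* 0)).

Definition complex_act : (vfield M)[i] -> (smooth M)[i] -> (smooth M)[i] :=
  complex_bilinear (@vfield_act R 3 M).

End NewmanPenrose.

(* Main.v *)
(* On a trans-Sasakian manifold the condition on (nabla phi) evaluated at xi gives
     nabla_X xi = - alpha phi X + beta (X - eta(X) xi).
   Differentiating once more and tracing over the frame (with phi e1 = e2) yields
     Delta xi = 2 (alpha^2 + beta^2) xi - (e1 beta + e2 alpha) e1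
                - (e2 beta - e1 alpha) e2,   |nabla xi|^2 = 2 (alpha^2 + beta^2),
   while rho = beta + i alpha, so that the real and imaginary parts of
   sqrt 2 * partial rho are e1 beta + e2 alpha and e1 alpha - e2 beta. *)
Require Import Defs.
From mathcomp Require Import all_boot all_order all_algebra.
From mathcomp Require Import all_classical all_reals all_analysis.
From mathcomp.real_closed Require Import complex.
From mathcomp Require Import ring.
Import Order.TTheory GRing.Theory Num.Theory.
Local Open Scope ring_scope.
Local Open Scope complex_scope.

(** * Vector fields, metrics and connections as algebra over the smooth functions *)

Section VectorFields.
Context {R : realType} {n : nat} {M : manifoldType R n}.
Implicit Types (X Y Z : vfield M) (f h : smooth M) (g : metric M) (D : connection M).

Lemma vfieldM X f h : X (f * h) = X f * h + f * X h.
Proof. by case: X => X /= /asboolP[]. Qed.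

Lemma vfield1 X : X 1 = 0.
Proof.
have := vfieldM X 1 1; rewrite !(mulr1, mul1r) => h.
by apply: (addrI (X 1)); rewrite addr0 -h.
Qed.

Lemma vfieldZ f X h : (f *: X) h = f * X h.
Proof. by []. Qed.

Lemma vfieldN X h : (- X) h = - X h.
Proof. by []. Qed.

Lemma smooth_cstM (a b : R) :
  smooth_cst a * smooth_cst b = smooth_cst (a * b) :> smooth M.
Proof. by apply: val_inj. Qed.

Lemma smooth_cst1 : smooth_cst 1 = 1 :> smooth M.
Proof. by apply: val_inj. Qed.

Lemma smooth_cst2 : smooth_cst 2 = 2 :> smooth M.
Proof. by apply: val_inj. Qed.

Lemma smooth_cst_unit (a : R) : a != 0 ->
  smooth_cst a^-1 * smooth_cst a = 1 :> smooth M.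
Proof. by move=> a0; rewrite smooth_cstM mulVf // smooth_cst1. Qed.

(** The constant 1/2 is a smooth function, so 2 is invertible in [smooth M]. *)
Lemma smooth_mulr2_eq0 f : f + f = 0 -> f = 0.
Proof.
move=> ff; rewrite -[f]mul1r -(smooth_cst_unit 2) ?pnatr_eq0 // -mulrA smooth_cst2.
by rewrite mulrDl mul1r ff mulr0.
Qed.

Lemma isqrt2_sqr :
  smooth_cst (Num.sqrt 2)^-1 * smooth_cst (Num.sqrt 2)^-1 * 2 = 1 :> smooth M.
Proof.
rewrite -smooth_cst2 !smooth_cstM -invfM -expr2 sqr_sqrtr ?ler0n //.
by rewrite mulVf ?pnatr_eq0 // smooth_cst1.
Qed.

Lemma metricD g X Y Z : g (X + Y) Z = g X Z + g Y Z.
Proof. by have := metric_linear g 1 X Y Z; rewrite scale1r mul1r. Qed.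

Lemma metric0 g Z : g 0 Z = 0.
Proof. by apply: (addrI (g 0 Z)); rewrite -metricD !addr0. Qed.

Lemma metricZ g f X Z : g (f *: X) Z = f * g X Z.
Proof. by have := metric_linear g f X 0 Z; rewrite metric0 !addr0. Qed.

Lemma metricN g X Z : g (- X) Z = - g X Z.
Proof. by rewrite -scaleN1r metricZ mulN1r. Qed.

Lemma metricDr g X Y Z : g Z (X + Y) = g Z X + g Z Y.
Proof. by rewrite !(metricC g Z) metricD. Qed.

Lemma metricZr g f X Z : g Z (f *: X) = f * g Z X.
Proof. by rewrite !(metricC g Z) metricZ. Qed.

Lemma metricNr g X Z : g Z (- X) = - g Z X.
Proof. by rewrite !(metricC g Z) metricN. Qed.

Lemma metric0r g Z : g Z 0 = 0.
Proof. by rewrite metricC metric0. Qed.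

Definition metricE :=
  (metricD, metric0, metric0r, metricZ, metricN, metricDr, metricZr, metricNr).

(** Taking [Z = X - Y], definiteness makes [X - Y] vanish at every point. Vector identities thus
    reduce to scalar ones, which [ring] can settle. *)
Lemma metric_nondegenerate g X Y : (forall Z, g X Z = g Y Z) -> X = Y.
Proof.
move=> gXY; apply/eqP; rewrite -subr_eq0; apply/eqP.
have g0 : g (X - Y) (X - Y) = 0 by rewrite metricD metricN gXY subrr.
apply: val_inj; apply/funext => f; apply: val_inj; apply/funext => p /=.
have /metric_eq0 /(congr1 (fun v => v f)) : g (X - Y) (X - Y) p = 0 by rewrite g0.
by [].
Qed.

Lemma nabla0 D X : D X 0 = 0.
Proof. by apply: (addrI (D X 0)); rewrite -nablaD !addr0. Qed.

Lemma nablaN D X Y : D X (- Y) = - D X Y.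
Proof. by apply: (addrI (D X Y)); rewrite -nablaD !subrr nabla0. Qed.

Lemma nabla0l D Y : D 0 Y = 0.
Proof.
have := nabla_linear D 1 0 0 Y; rewrite !scale1r addr0 => h.
by apply: (addrI (D 0 Y)); rewrite addr0 -h.
Qed.

Lemma nablaZl D f X Y : D (f *: X) Y = f *: D X Y.
Proof. by have := nabla_linear D f X 0 Y; rewrite nabla0l !addr0. Qed.

End VectorFields.

(** * First and second covariant derivatives of [xi] *)

Section TransSasakian.
Context {R : realType} {n : nat} {M : manifoldType R n}.
Context {S : almost_contact_metric M}.
Local Notation g := (acm_metric S).
Implicit Types X Y Z : vfield M.

Lemma metric_xi X : g X (xi S) = eta S X.
Proof.
have := metric_phi S X (xi S); rewrite phi_xi eta_xi mulr1 metricC metric0.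
by move=> /esym/eqP; rewrite subr_eq0 => /eqP.
Qed.

Context {D : connection M} {alpha beta : smooth M}.
Context (hD : levi_civita g D) (hS : trans_sasakian S D alpha beta).

(** Differentiate the constant g(xi, xi) = 1. *)
Lemma eta_nabla_xi X : eta S (D X (xi S)) = 0.
Proof.
apply: smooth_mulr2_eq0; have [_ /(_ X (xi S) (xi S))] := hD.
by rewrite !(metricC _ (xi S)) !metric_xi eta_xi vfield1.
Qed.

(** Apply [phi] to the trans-Sasakian condition at [Y = xi]: [phi_phi] gives back [D X (xi S)], as
    its [eta] component is zero. *)
Lemma nabla_xi X :
  D X (xi S) = - (alpha *: phi S X) + beta *: (X - eta S X *: xi S).
Proof.
have := congr1 (phi S) (hS X (xi S)).
rewrite phi_xi nabla0 sub0r linearN /= phi_phi eta_nabla_xi scale0r addr0 opprK.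
rewrite !metric_xi eta_xi eta_phi !scale1r scale0r sub0r => ->.
rewrite linearD !linearZ /= linearB /= linearZ /= linearN /= phi_xi scaler0 sub0r.
by rewrite phi_phi opprD opprK !scalerN.
Qed.

Lemma vfield_eta X Y : X (eta S Y) = eta S (D X Y) + g Y (D X (xi S)).
Proof. by have [_ /(_ X Y (xi S))] := hD; rewrite !metric_xi. Qed.

(** Leibniz rule on [nabla_xi]. The factor of [alpha] keeps the shape (nabla_X phi) X, so that the
    trans-Sasakian condition can replace it. The part eta(nabla_X X) of X(eta X) cancels against the
    subtracted term. *)
Lemma nabla2_xi X :
  D X (D X (xi S)) - D (D X X) (xi S) =
    - (X alpha *: phi S X)
    - alpha *: (D X (phi S X) - phi S (D X X))
    + X beta *: (X - eta S X *: xi S)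
    - beta *: (g X (D X (xi S)) *: xi S + eta S X *: D X (xi S)).
Proof.
rewrite {1}(nabla_xi X) (nabla_xi (D X X)).
rewrite nablaD nablaN !nabla_leibniz nablaD nablaN nabla_leibniz vfield_eta.
by apply: (@metric_nondegenerate _ _ _ g) => Z; rewrite !metricE; ring.
Qed.

End TransSasakian.

(** * Computations in the Newman--Penrose frame *)

Section NewmanPenrose.
Context {R : realType} {M : manifoldType R 3}.
Context {S : almost_contact_metric M} {e1 e2 : vfield M}.
Context (he : np_frame S e1 e2).
Local Notation g := (acm_metric S).
Local Notation isqrt2 := (smooth_cst (Num.sqrt 2)^-1 : smooth M).

(** Stated for modules to serve both vector fields and, through [(smooth M)^o], functions. *)
Lemma isqrt2K (V : lmodType (smooth M)) (u : V) :
  (smooth_cst (Num.sqrt 2) : smooth M) *: (isqrt2 *: u) = u.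
Proof.
by rewrite scalerA mulrC smooth_cst_unit ?scale1r // sqrtr_eq0 -ltNge ltr0n.
Qed.

Lemma isqrt2_mul_eq0 (f : smooth M) : isqrt2 * f = 0 -> f = 0.
Proof. by move=> f0; rewrite -[f](@isqrt2K (smooth M)^o) [isqrt2 *: _]f0 scaler0. Qed.

(** Real and imaginary parts of the eigenvector equation for [np_d], with 1/sqrt 2 cancelled. *)
Lemma np_phi : phi S e1 = e2 /\ phi S e2 = - e1.
Proof.
have [_ + _] := he; rewrite /complex_linear /complex_scale /= => -[E1 E2].
(* [opprK] and [add0r] get explicit arguments because the structure instances
   in E1 and E2 are reached through other inheritance paths than those
   inferred for [vfield M]. *)
have h1 : isqrt2 *: phi S e1 = isqrt2 *: e2.
  by rewrite -linearZ /= E1 scale0r scale1r sub0r (opprK (isqrt2 *: e2)).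
have h2 : isqrt2 *: phi S e2 = isqrt2 *: - e1.
  rewrite -linearZ scalerN; apply: oppr_inj; rewrite opprK.
  apply: etrans (etrans E2 _); first by rewrite linearN.
  by rewrite scale0r scale1r (add0r (isqrt2 *: e1)).
by split; rewrite -[LHS]isqrt2K -[RHS]isqrt2K ?h1 ?h2.
Qed.

Lemma np_metric :
  [/\ g e1 e1 = 1, g e2 e2 = 1, g e1 e2 = 0, eta S e1 = 0 & eta S e2 = 0].
Proof.
have [[_ o] _ _] := he; pose k i : 'I_3 := inord i.
have oE i j : (i < 3)%N -> (j < 3)%N ->
    g (frame3 S e1 e2 (k i)) (frame3 S e1 e2 (k j)) = (i == j)%:R.
  by move=> i3 j3; rewrite o -val_eqE /= !inordK.
have [p1 p2] := np_phi.
(* [e1] and [e2] lie in the image of [phi], where [eta] vanishes. *)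
have eta1 : eta S e1 = 0.
  by rewrite -[e1]opprK -p2 -scaleN1r -[_ *: _]linearZ /= eta_phi.
have eta2 : eta S e2 = 0 by rewrite -p1 eta_phi.
by split=> //; [have := oE 0 0 isT isT|have := oE 1 1 isT isT
  |have := oE 0 1 isT isT]; rewrite /frame3 !(tnth_nth 0) /= !inordK.
Qed.

Context {D : connection M} {alpha beta : smooth M}.
Context (hD : levi_civita g D) (hS : trans_sasakian S D alpha beta).

Lemma np_nabla_xi :
  [/\ D e1 (xi S) = - (alpha *: e2) + beta *: e1,
      D e2 (xi S) = alpha *: e1 + beta *: e2 & D (xi S) (xi S) = 0].
Proof.
have [p1 p2] := np_phi; have [_ _ _ h1 h2] := np_metric.
rewrite !(nabla_xi hD hS) p1 p2 h1 h2 phi_xi eta_xi !scale0r scale1r !subr0.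
by rewrite subrr !scaler0 oppr0 addr0 scalerN opprK.
Qed.

Lemma np_sqnorm_nabla_xi :
  sqnorm_nabla g D (frame3 S e1 e2) (xi S) = 2 * (alpha ^+ 2 + beta ^+ 2).
Proof.
have [n1 n2 n3] := np_nabla_xi; have [g11 g22 g12 _ _] := np_metric.
rewrite /sqnorm_nabla !big_ord_recl big_ord0 /frame3 !(tnth_nth 0) /=.
rewrite n1 n2 n3 !metricE (metricC _ e2 e1) g11 g22 g12; ring.
Qed.

Lemma np_rough_laplacian_xi :
  rough_laplacian D (frame3 S e1 e2) (xi S) =
    (2 * (alpha ^+ 2 + beta ^+ 2)) *: xi S
    - (e1 beta + e2 alpha) *: e1 - (e2 beta - e1 alpha) *: e2.
Proof.
have [n1 n2 n3] := np_nabla_xi; have [g11 g22 g12 h1 h2] := np_metric.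
have [p1 p2] := np_phi.
rewrite /rough_laplacian !big_ord_recl big_ord0 /frame3 !(tnth_nth 0) /=.
(* [hS] must act before [p1] and [p2] rewrite the [phi] terms it matches. The summand for [xi]
   contributes zero. *)
rewrite !(nabla2_xi hD hS) !hS n1 n2 n3 p1 p2 h1 h2 phi_xi eta_xi.
apply: (@metric_nondegenerate _ _ _ g) => Z.
rewrite !metricE (metricC _ e2 e1) g11 g22 g12 !metric_xi eta_xi; ring.
Qed.

Lemma np_rhoE : np_rho S D e1 e2 = beta +i* alpha.
Proof.
have [n1 n2 _] := np_nabla_xi; have [g11 g22 g12 _ _] := np_metric.
rewrite /np_rho /complex_bilinear /np_d /np_dbar !nabla0 subr0 add0r !nablaZl n1 n2.
rewrite !metricE (metricC _ e2 e1) g11 g22 g12.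
(* To [ring], [isqrt2] is an atom, so a factor 1 is inserted on the right in the form of
   [isqrt2_sqr]. *)
have isqrt2E (f : smooth M) : f = isqrt2 * isqrt2 * 2 * f.
  by rewrite isqrt2_sqr mul1r.
by congr (_ +i* _); rewrite [RHS]isqrt2E; ring.
Qed.

Lemma np_actE f h : complex_act (np_d e1 e2) (f +i* h) =
  (isqrt2 * (e1 f + e2 h)) +i* (isqrt2 * (e1 h - e2 f)).
Proof.
by rewrite /complex_act /complex_bilinear /np_d !vfieldN !vfieldZ opprK -!mulrDr mulrBr.
Qed.

(** Pairing with [e1] and with [e2] isolates each coefficient. *)
Lemma np_frame_free (u v : smooth M) : u *: e1 + v *: e2 = 0 -> u = 0 /\ v = 0.
Proof.
have [g11 g22 g12 _ _] := np_metric => uv.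
have := (congr1 (fun X => g X e1) uv, congr1 (fun X => g X e2) uv).
rewrite /= !metricE (metricC _ e2 e1) g11 g22 g12.
by rewrite !(mulr0, mulr1) addr0 add0r => -[-> ->].
Qed.

End NewmanPenrose.

Theorem theorem5p12 (R : realType) (M : manifoldType R 3)
    (S : almost_contact_metric M) (D : connection M)
    (alpha beta : smooth M) (e1 e2 : vfield M)
    (hD : levi_civita (acm_metric S) D)
    (hS : trans_sasakian S D alpha beta)
    (he : np_frame S e1 e2) :
  harmonic_field (acm_metric S) D (frame3 S e1 e2) (xi S) <->
  complex_act (np_d e1 e2) (np_rho S D e1 e2) = 0 +i* 0.
Proof.
rewrite /harmonic_field (np_rough_laplacian_xi he hD hS).
rewrite (np_sqnorm_nabla_xi he hD hS) (np_rhoE he hD hS) np_actE -addrA.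
split=> [/eqP|E].
  (* The multiples of [xi] on both sides coincide; what remains is the part along [e1] and [e2]. *)
  rewrite addrC -subr_eq0 addrK -opprD oppr_eq0 => /eqP /(np_frame_free he)[-> h].
  (* The imaginary part carries the opposite sign to the [e2] coefficient in [h]. *)
  by rewrite -opprB h oppr0 !mulr0.
have /isqrt2_mul_eq0 -> := congr1 (@complex.Re _) E.
have /isqrt2_mul_eq0 h := congr1 (@complex.Im _) E.
by rewrite -(opprB (e1 alpha)) h oppr0 !scale0r !subr0.
Qed.
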